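(* (i) If $t=n-2\ge 3$, the first three graphs, in the $S$-order, among $\mathscr{L}_{n,n-2}$ are $J_1\prec_s J_2\prec_s J_3$; that is, these relations hold and $J_3\prec_s G$ for every $G\in\mathscr{L}_{n,n-2}\setminus\{J_1,J_2,J_3\}$. (ii) If $t=n-3\ge 3$, the first seven graphs, in the $S$-order, among $\mathscr{L}_{n,n-3}$ are $J_4\prec_s J_5\prec_s J_6\prec_s J_7\prec_s J_8\prec_s J_9\prec_s J_{10}$; that is, these relations hold and $J_{10}\prec_s G$ for every $G\in\mathscr{L}_{n,n-3}\setminus\{J_4,\dots,J_{10}\}$.
   Context: All graphs are finite, simple and connected, and are considered up to isomorphism. For $2\le t\le n$, $\mathscr{L}_{n,t}$ is the set of all $n$-vertex connected graphs with clique number $t$. The $n$-vertex graphs $J_1,J_2,J_3$ are obtained from the complete graph $K_{n-2}$ by adding two new vertices, as follows. - $J_1$: attach a path of length 2 by one of its ends to a vertex of $K_{n-2}$. - $J_2$: attach one pendant vertex to each of two distinct vertices of $K_{n-2}$. - $J_3$: attach two pendant vertices to the same vertex of $K_{n-2}$. The $n$-vertex graphs $J_4,\dots,J_{10}$ are obtained from the complete graph $K_{n-3}$ by adding three new vertices, as follows. - $J_4$: attach a path of length 3 by one of its ends to a vertex of $K_{n-3}$. - $J_5$: join a new vertex $x$ to one vertex of $K_{n-3}$ and attach two pendant vertices to $x$. - $J_6$: attach a path of length 2 by one of its ends to a vertex of $K_{n-3}$ and a pendant vertex to a different vertex of $K_{n-3}$. - $J_7$: attach a path of length 2 (by one of its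 ends) and a pendant vertex to the same vertex of $K_{n-3}$. - $J_8$: attach one pendant vertex to each of three distinct vertices of $K_{n-3}$. - $J_9$: attach two pendant vertices to one vertex of $K_{n-3}$ and one pendant vertex to a different vertex of $K_{n-3}$. - $J_{10}$: attach three pendant vertices to the same vertex of $K_{n-3}$. For an $n$-vertex graph $G$ with adjacency eigenvalues $\lambda_1(G),\dots,\lambda_n(G)$, the $k$th spectral moment is $S_k(G)=\sum_{i=1}^n\lambda_i(G)^k$, $k=0,1,\dots,n-1$. For two $n$-vertex graphs $G_1,G_2$ write $G_1\prec_s G_2$ ($G_1$ comes before $G_2$ in the $S$-order) if for some $k$ with $1\le k\le n-1$ we have $S_i(G_1)=S_i(G_2)$ for $i=0,1,\dots,k-1$ and $S_k(G_1)<S_k(G_2)$. *)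

(* Defs.v *)
From mathcomp Require Import all_boot all_order all_algebra all_field.

Set Implicit Arguments.
Unset Strict Implicit.
Unset Printing Implicit Defensive.

Import Order.TTheory GRing.Theory Num.Theory.

Record sgraph (n : nat) := SGraph {
  adj :> rel 'I_n;
  adj_sym : symmetric adj;
  adj_irrefl : irreflexive adj }.

Definition isomorphic n (G H : sgraph n) : Prop :=
  exists2 f : 'I_n -> 'I_n, bijective f & {mono f : x y / G x y >-> H x y}.

Definition connected n (G : sgraph n) : bool :=
  [forall x, forall y, connect G x y].

Definition clique n (G : sgraph n) (A : {set 'I_n}) : bool :=
  [forall x in A, forall y in A, (x != y) ==> G x y].

Definition clique_number n (G : sgraph n) : nat :=
  \max_(A : {set 'I_n} | clique G A) #|A|.

Definition in_L n t (G : sgraph n) : bool :=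
  connected G && (clique_number G == t).

Definition adjmx n (G : sgraph n) : 'M[algC]_n :=
  (\matrix_(i, j) (G i j)%:R)%R.

(* All complex roots of the characteristic polynomial, with multiplicity. *)
Definition eigenvalues n (A : 'M[algC]_n) : seq algC :=
  sval (closed_field_poly_normal (char_poly A)).

Lemma eigenvaluesP n (A : 'M[algC]_n) :
  char_poly A = (\prod_(z <- eigenvalues A) ('X - z%:P))%R.
Proof.
rewrite /eigenvalues; case: closed_field_poly_normal => r /= Er.
by rewrite {1}Er (monicP (char_poly_monic A)) scale1r.
Qed.

Definition spectral_moment n (G : sgraph n) (k : nat) : algC :=
  (\sum_(z <- eigenvalues (adjmx G)) z ^+ k)%R.

(* The adjacency matrix is real symmetric, so spectral moments are real; [<]
   on algC restricts to the usual order on real algebraic numbers. *)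
Definition precS n (G H : sgraph n) : Prop :=
  exists k : nat,
    [/\ 1 <= k <= n.-1,
        forall i, i < k -> spectral_moment G i = spectral_moment H i
      & (spectral_moment G k < spectral_moment H k)%R].

(* The graph on 0, ..., n-1 in which 0, ..., m-1 induce K_m, together with the
   extra edges listed in E. *)
Definition clique_plus_rel n m (E : seq (nat * nat)) : rel 'I_n :=
  fun x y => (x != y) &&
    [|| (x < m) && (y < m),
        (val x, val y) \in E | (val y, val x) \in E].

Lemma clique_plus_sym n m E : symmetric (@clique_plus_rel n m E).
Proof.
by move=> x y; rewrite /clique_plus_rel eq_sym [(y < m) && _]andbC
  [X in _ && (_ || X)]orbC.
Qed.

Lemma clique_plus_irrefl n m E : irreflexive (@clique_plus_rel n m E).
Proof. by move=> x; rewrite /clique_plus_rel eqxx. Qed.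

Definition clique_plus n m E : sgraph n :=
  SGraph (@clique_plus_sym n m E) (@clique_plus_irrefl n m E).

(* In J1, J2, J3 the vertices n-2, n-1 are the new ones; in J4, ..., J10 the
   vertices n-3, n-2, n-1 are. *)
Definition J1 n := clique_plus n (n - 2) [:: (0, n - 2); (n - 2, n - 1)].
Definition J2 n := clique_plus n (n - 2) [:: (0, n - 2); (1, n - 1)].
Definition J3 n := clique_plus n (n - 2) [:: (0, n - 2); (0, n - 1)].

Definition J4 n := clique_plus n (n - 3)
  [:: (0, n - 3); (n - 3, n - 2); (n - 2, n - 1)].
Definition J5 n := clique_plus n (n - 3)
  [:: (0, n - 3); (n - 3, n - 2); (n - 3, n - 1)].
Definition J6 n := clique_plus n (n - 3)
  [:: (0, n - 3); (n - 3, n - 2); (1, n - 1)].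
Definition J7 n := clique_plus n (n - 3)
  [:: (0, n - 3); (n - 3, n - 2); (0, n - 1)].
Definition J8 n := clique_plus n (n - 3)
  [:: (0, n - 3); (1, n - 2); (2, n - 1)].
Definition J9 n := clique_plus n (n - 3)
  [:: (0, n - 3); (0, n - 2); (1, n - 1)].
Definition J10 n := clique_plus n (n - 3)
  [:: (0, n - 3); (0, n - 2); (0, n - 1)].

(* Main.v *)
Require Import Defs.
From mathcomp Require Import all_boot all_order all_algebra all_field.
From mathcomp Require Import zify ring.

Set Implicit Arguments.
Unset Strict Implicit.
Unset Printing Implicit Defensive.

Import Order.TTheory GRing.Theory Num.Theory.

(** Spectral moments count closed walks: [S_k] is the trace of the [k]-th power of
    the adjacency matrix ([spectral_momentE]).  So [S_0] and [S_1] are the same for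
    all graphs on [n] vertices, and [S_2] is twice the number of edges.

    A connected graph with a clique on [m] vertices and [r] vertices outside has at
    least [r] edges besides those of the clique: exploring the graph from the clique,
    each outside vertex is reached along an edge from an earlier vertex.  If there are
    no further edges, then the graph is determined by the list of parents in this
    exploration, and for [r = 2] and [r = 3] a case analysis of the parents leaves
    exactly the graphs [J1] to [J3] and [J4] to [J10] ([classify2], [classify3]).  Any
    other graph has more edges and comes later because of [S_2] ([precS_arcs]).

    The graphs [J_i] are compared by growing them from the clique, one pendant vertex
    at a time.  A vertex made pendant at [u] adds 2 to [S_2], nothing to [S_3], [4 d + 2]
    to [S_4] with [d] the current degree of [u], and to [S_5] it adds 10 times the
    number of triangles at [u] ([mxtrace_pendant2] to [mxtrace_pendant5]).  Hence [S_4]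
    compares the sums of the parents' degrees ([precS_pendants]).  These sums settle all
    comparisons except [J5] with [J6] and [J7] with [J8] over a triangle, where they tie
    and [S_5] compares the numbers of parents in the clique ([precS_pendants5]). *)

(** * Spectral moments as traces *)

Local Open Scope ring_scope.

(** Similar matrices share their characteristic polynomial because the determinants
    of [P] and its inverse cancel, also after both are read over polynomials. *)
Lemma char_poly_conj n (P A : 'M[algC]_n) :
  P \in unitmx -> char_poly (invmx P *m A *m P) = char_poly A.
Proof.
move=> uP; pose C (M : 'M[algC]_n) := map_mx (@polyC algC) M.
rewrite /char_poly.
have -> : char_poly_mx (invmx P *m A *m P) =
    C (invmx P) *m char_poly_mx A *m C P.
  rewrite /char_poly_mx mulmxBr mulmxBl /C !map_mxM; congr (_ - _).
  by rewrite scalar_mxC -mulmxA -map_mxM mulVmx // map_mx1 mulmx1.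
rewrite !det_mulmx mulrAC -det_mulmx.
by rewrite -map_mxM mulVmx // map_mx1 det1 mul1r.
Qed.

Lemma exprmx_conj n (P A : 'M[algC]_n) k :
  P \in unitmx -> (invmx P *m A *m P) ^+ k = invmx P *m A ^+ k *m P.
Proof.
move=> uP; elim: k => [|k IHk]; first by rewrite !expr0 mulmx1 mulVmx.
by rewrite exprS IHk exprS -!mulmxE !mulmxA mulmxK.
Qed.

Lemma exprmx_diag n (d : 'rV[algC]_n) k :
  diag_mx d ^+ k = diag_mx (\row_i d 0 i ^+ k).
Proof.
elim: k => [|k IHk].
  by apply/matrixP=> i j; rewrite expr0 !mxE expr0.
rewrite exprS IHk -mulmxE mulmx_diag; congr diag_mx.
by apply/rowP=> i; rewrite !mxE exprS.
Qed.

Lemma adjmx_tr n (G : sgraph n) : (adjmx G)^T = adjmx G.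
Proof. by apply/matrixP=> i j; rewrite !mxE adj_sym. Qed.

Lemma adjmx_normal n (G : sgraph n) : adjmx G \is normalmx.
Proof.
suff conjA : map_mx Num.conj (adjmx G)^T = adjmx G.
  by apply/normalmxP; rewrite conjA.
by rewrite adjmx_tr; apply/matrixP=> i j; rewrite !mxE conjC_nat.
Qed.

(** A real symmetric matrix is unitarily similar to the diagonal matrix of its
    eigenvalues, so its power sums of eigenvalues are traces of powers: they count
    closed walks, and counting replaces any knowledge of the spectrum. *)
Lemma spectral_momentE n (G : sgraph n) k :
  spectral_moment G k = \tr (adjmx G ^+ k).
Proof.
set A := adjmx G.
have /orthomx_spectralP := adjmx_normal G; rewrite -/A.
set P := spectralmx A; set d := spectral_diag A => AE.
have uP : P \in unitmx := spectral_unit A.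
have rootsA : perm_eq (eigenvalues A) [seq d 0 i | i : 'I_n].
  apply: prod_XsubC_eq; rewrite -eigenvaluesP {1}AE char_poly_conj //.
  rewrite char_poly_trig ?diag_mx_is_trig // big_image /=.
  by apply: eq_bigr => i _; rewrite mxE eqxx.
rewrite /spectral_moment -/A (perm_big _ rootsA) big_image /=.
rewrite {1}AE exprmx_conj // mxtrace_mulC mulmxA mulmxV // mul1mx.
rewrite exprmx_diag mxtrace_diag; by apply: eq_bigr => i _; rewrite mxE.
Qed.

(** * Traces after adding a pendant vertex *)

(** The three relations on [a] and [s] hold when [s] is the adjacency matrix of a
    single edge, one of whose ends is isolated in the graph of [a] while the other
    carries no loop: a closed walk cannot enter the new edge and leave it on the
    far side, so the edge is traversed back and forth.  Under these relations nearly
    all words in the expansion of a power of [a + s] vanish, and the trace kills or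
    identifies the others up to rotation. *)
Section AddEdge.
Variables (R : comNzRingType) (n : nat) (a s : 'M[R]_n).
Hypotheses (asa : a * s * a = 0) (sas : s * a * s = 0) (sss : s * s * s = s).

Let trC (x y : 'M[R]_n) : \tr (x * y) = \tr (y * x).
Proof. exact: mxtrace_mulC. Qed.

Let wasa t : t * a * s * a = 0. Proof. by rewrite -!mulrA (mulrA a) asa mulr0. Qed.
Let wsas t : t * s * a * s = 0. Proof. by rewrite -!mulrA (mulrA s) sas mulr0. Qed.
Let wsss t : t * s * s * s = t * s. Proof. by rewrite -!mulrA (mulrA s) sss. Qed.
Let zeros := (asa, wasa, sas, wsas, sss, wsss, mul0r, mulr0, addr0, add0r, mxtrace0).

Lemma sqr_add_edge : (a + s) ^+ 2 = a * a + a * s + s * a + s * s.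
Proof. by rewrite !expr2 mulrDl !mulrDr !addrA. Qed.

Lemma cube_add_edge :
  (a + s) ^+ 3 = a * a * a + s * a * a + s * s * a + a * a * s + a * s * s + s.
Proof. by rewrite exprSr sqr_add_edge mulrDr !mulrDl !zeros !addrA. Qed.

(* Moves the last letter of a word under the trace to the front, then reduces. *)
Ltac rotate := rewrite trC ?mulrA ?zeros.

Let tr_as : \tr (a * s) = 0.
Proof. by rewrite -sss !mulrA; rotate. Qed.
Let tr_sa : \tr (s * a) = 0. Proof. by rewrite trC. Qed.
Let tr_aas : \tr (a * a * s) = 0. Proof. by do 2 rotate. Qed.
Let tr_saa : \tr (s * a * a) = 0. Proof. by rotate. Qed.
Let tr_ass : \tr (a * s * s) = 0. Proof. by rotate. Qed.
Let tr_ssa : \tr (s * s * a) = 0. Proof. by do 2 rotate. Qed.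

Let short := (tr_as, tr_sa, tr_aas, tr_saa, tr_ass, tr_ssa, addr0, @add0r).

Lemma mxtrace_add_edge2 : \tr ((a + s) ^+ 2) = \tr (a ^+ 2) + \tr (s ^+ 2).
Proof. by rewrite sqr_add_edge !raddfD /= !short !expr2. Qed.

Lemma mxtrace_add_edge3 : \tr ((a + s) ^+ 3) = \tr (a ^+ 3) + \tr s.
Proof. by rewrite cube_add_edge !raddfD /= !short exprSr expr2. Qed.

Lemma mxtrace_add_edge4 :
  \tr ((a + s) ^+ 4) = \tr (a ^+ 4) + \tr (a ^+ 2 * s ^+ 2) *+ 4 + \tr (s ^+ 2).
Proof.
have w1 : \tr (a * a * a * s) = 0 by do 2 rotate.
have w2 : \tr (s * a * a * a) = 0 by do 1 rotate.
have w3 : \tr (s * a * a * s) = \tr (a * a * s * s) by do 3 rotate.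
have w4 : \tr (s * s * a * a) = \tr (a * a * s * s) by do 2 rotate.
have w5 : \tr (a * s * s * a) = \tr (a * a * s * s) by do 1 rotate.
rewrite exprSr cube_add_edge ?(mulrDl, mulrDr) ?mulrA ?zeros !raddfD /=.
rewrite w1 w2 w3 w4 w5 !short !exprS !mulr1 !mulrA.
by ring.
Qed.

Lemma mxtrace_add_edge5 :
  \tr ((a + s) ^+ 5) = \tr (a ^+ 5) + \tr (a ^+ 3 * s ^+ 2) *+ 5 + \tr s.
Proof.
have w1 : \tr (a * a * a * a * s) = 0 by do 2 rotate.
have w2 : \tr (s * a * a * a * a) = 0 by do 1 rotate.
have w3 : \tr (s * a * a * a * s) = \tr (a * a * a * s * s) by do 4 rotate.
have w4 : \tr (s * a * a * s * s) = 0 by do 3 rotate.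
have w5 : \tr (s * s * a * a * a) = \tr (a * a * a * s * s) by do 3 rotate.
have w6 : \tr (s * s * a * a * s) = 0 by do 2 rotate.
have w7 : \tr (a * a * s * s * a) = \tr (a * a * a * s * s) by do 1 rotate.
have w8 : \tr (a * s * s * a * a) = \tr (a * a * a * s * s) by do 2 rotate.
rewrite (exprD _ 3 2) cube_add_edge sqr_add_edge ?(mulrDl, mulrDr) ?mulrA ?zeros !raddfD /=.
rewrite w1 w2 w3 w4 w5 w6 w7 w8 !short !exprS !mulr1 !mulrA.
by ring.
Qed.
End AddEdge.

(** Specialization of the previous identities to [v], an isolated vertex of the graph
    of [A], being made pendant at [u].  The fourth moment records the degree of
    [u], the fifth the number of triangles at [u]; the changes of the second and third
    do not depend on [u] at all. *)
Section PendantEntries.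
Variables (R : comNzRingType) (n : nat).
Implicit Types (M : 'M[R]_n) (i j x y : 'I_n).

Lemma mulmx_deltaE M i j x y : (M * delta_mx i j) x y = M x i *+ (y == j).
Proof.
rewrite -mulmxE mxE (bigD1 i) //= big1 ?mxE ?eqxx ?addr0 ?mulr_natr //.
by move=> k ki; rewrite mxE (negPf ki) mulr0.
Qed.

Lemma delta_mulmxE M i j x y : (delta_mx i j * M) x y = M j y *+ (x == i).
Proof.
rewrite -mulmxE mxE (bigD1 j) //= big1 ?mxE ?eqxx ?addr0 ?andbT ?mulr_natl //.
by move=> k kj; rewrite mxE (negPf kj) andbF mul0r.
Qed.

Lemma mxtrace_delta M i j : \tr (M * delta_mx i j) = M j i.
Proof.
rewrite /mxtrace (bigD1 j) //= mulmx_deltaE eqxx big1 ?addr0 // => k kj.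
by rewrite mulmx_deltaE (negPf kj).
Qed.

Variables (A : 'M[R]_n) (u v : 'I_n).
Hypothesis uv : u != v.
Hypotheses (Auu : A u u = 0) (Avx : forall x, A v x = 0) (Axv : forall x, A x v = 0).
Let S : 'M[R]_n := delta_mx u v + delta_mx v u.

Let vu : v != u. Proof. by rewrite eq_sym. Qed.

Let SE M x y : (M * S) x y = M x u *+ (y == v) + M x v *+ (y == u).
Proof. by rewrite mulrDr mxE !mulmx_deltaE. Qed.

Let ES M x y : (S * M) x y = M v y *+ (x == u) + M u y *+ (x == v).
Proof. by rewrite mulrDl mxE !delta_mulmxE. Qed.

Let S2 : S ^+ 2 = delta_mx u u + delta_mx v v.
Proof.
rewrite expr2 mulrDl !mulrDr -!mulmxE !mul_delta_mx.
by rewrite !mul_delta_mx_0 // add0r addr0.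
Qed.

Let SSE M x y : (M * S ^+ 2) x y = M x u *+ (y == u) + M x v *+ (y == v).
Proof. by rewrite S2 mulrDr mxE !mulmx_deltaE. Qed.

Let ESS M x y : (S ^+ 2 * M) x y = M u y *+ (x == u) + M v y *+ (x == v).
Proof. by rewrite S2 mulrDl mxE !delta_mulmxE. Qed.

Let SSS : S * S * S = S.
Proof.
rewrite -expr2 S2 mulrDl !mulrDr -!mulmxE !mul_delta_mx.
by rewrite !mul_delta_mx_0 // add0r addr0.
Qed.

Let ASA : A * S * A = 0.
Proof.
apply/matrixP=> x y; rewrite mxE -mulmxE mxE big1 // => j _.
by rewrite mulmxE SE Axv; case: eqP => [->|_]; rewrite ?Avx ?mulr0 // mul0rn addr0 mul0r.
Qed.

Let SAS : S * A * S = 0.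
Proof.
apply/matrixP=> x y; rewrite [RHS]mxE SE !ES !Avx !Axv Auu.
by rewrite !mul0rn !addr0 !mul0rn addr0.
Qed.

Let power_vx k x : (A ^+ k.+1) v x = 0.
Proof. by rewrite exprS -mulmxE mxE big1 // => j _; rewrite Avx mul0r. Qed.

Let power_xv k x : (A ^+ k.+1) x v = 0.
Proof. by rewrite exprSr -mulmxE mxE big1 // => j _; rewrite Axv mulr0. Qed.

(* [S ^+ 2] is the projection on the coordinates [u] and [v], so the trace of a
   power of [A] against it is a single diagonal entry. *)
Let trS2 k : \tr (A ^+ k.+1 * S ^+ 2) = (A ^+ k.+1) u u.
Proof. by rewrite S2 mulrDr raddfD /= !mxtrace_delta power_vx addr0. Qed.

Let trS : \tr S = 0.
Proof. by rewrite -[S]mul1r mulrDr raddfD /= !mxtrace_delta !mxE (negPf uv) (negPf vu) addr0. Qed.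

Let trSS : \tr (S ^+ 2) = 2.
Proof. by rewrite S2 -[X in \tr X]mul1r mulrDr raddfD /= !mxtrace_delta !mxE !eqxx. Qed.

Lemma mxtrace_pendant2 : \tr ((A + S) ^+ 2) = \tr (A ^+ 2) + 2.
Proof. by rewrite mxtrace_add_edge2 // trSS. Qed.

Lemma mxtrace_pendant3 : \tr ((A + S) ^+ 3) = \tr (A ^+ 3).
Proof. by rewrite mxtrace_add_edge3 // trS addr0. Qed.

Lemma mxtrace_pendant4 :
  \tr ((A + S) ^+ 4) = \tr (A ^+ 4) + (A ^+ 2) u u *+ 4 + 2.
Proof. by rewrite mxtrace_add_edge4 // trSS trS2. Qed.

Lemma mxtrace_pendant5 :
  \tr ((A + S) ^+ 5) = \tr (A ^+ 5) + (A ^+ 3) u u *+ 5.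
Proof. by rewrite mxtrace_add_edge5 // trS trS2 addr0. Qed.

Let addE M N x y : (M + N) x y = M x y + N x y.
Proof. by rewrite mxE. Qed.

Let deltaE i j x y : (delta_mx i j : 'M[R]_n) x y = ((x == i) && (y == j))%:R.
Proof. by rewrite mxE. Qed.

Let noteq w : ((w == u) && (w == v) = false) /\ ((w == v) && (w == u) = false).
Proof.
by rewrite andbC; split; apply: contraNF uv => /andP[/eqP<- /eqP<-].
Qed.

Lemma diag_pendant2 w :
  ((A + S) ^+ 2) w w = (A ^+ 2) w w + ((w == u) + (w == v))%:R.
Proof.
rewrite sqr_add_edge -!expr2 S2 !addE SE ES !deltaE Avx Axv !andbb natrD addrA.
have [->|wu] := eqVneq w u; first by rewrite Auu (negPf uv) !mul0rn !addr0.
have [->|wv] := eqVneq w v; last by rewrite !mulr0n !addr0.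
by rewrite Avx Axv !mul0rn !addr0 add0r.
Qed.

Lemma diag_pendant3 w : ((A + S) ^+ 3) w w = (A ^+ 3) w w.
Proof.
rewrite cube_add_edge // -[_ * S * S]mulrA -!expr2 -[S * A * A]mulrA -[A * A]expr2 -(exprSr A 2).
rewrite !addE SE ES SSE ESS !deltaE !power_vx !power_xv.
have [-> ->] := noteq w.
have [->|wu] := eqVneq w u; first by rewrite (negPf uv) Auu !mul0rn !mulr0n !addr0.
have [->|wv] := eqVneq w v; last by rewrite !mulr0n !addr0.
by rewrite Avx !power_vx !power_xv !mul0rn !mulr0n !addr0.
Qed.
End PendantEntries.

Local Close Scope ring_scope.

(** * Growing graphs from a clique *)

(** The edge list of a growth process on a clique with vertices [0 .. m-1]: entry [j]
    of [ps] is the vertex to which the new vertex [m + j] is attached.  All ten graphs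
    [J1] to [J10] have this form. *)
Definition attach m (ps : seq nat) := zip ps (iota m (size ps)).

Definition pendants n m ps := clique_plus n m (attach m ps).

(** Each vertex is attached to one that already exists, so that every new vertex is
    pendant at the time when it appears. *)
Definition older_parents m ps := all (fun e => e.1 < e.2) (attach m ps).

Lemma attach_rcons m ps p :
  attach m (rcons ps p) = rcons (attach m ps) (p, m + size ps).
Proof. by rewrite /attach size_rcons -addn1 iotaD cats1 zip_rcons ?size_iota. Qed.

Lemma older_parents_rcons m ps p :
  older_parents m (rcons ps p) = (p < m + size ps) && older_parents m ps.
Proof. by rewrite /older_parents attach_rcons all_rcons. Qed.

Lemma mem_attach m ps a b : (a, b) \in attach m ps ->
  m <= b < m + size ps /\ a = nth 0 ps (b - m).
Proof.
elim/last_ind: ps => [|ps p IHps]; first by [].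
rewrite attach_rcons mem_rcons inE size_rcons addnS => /orP[/eqP[-> ->]|/IHps[b1 ->]].
  by rewrite leq_addr leqnn addKn nth_rcons ltnn eqxx.
split; first by lia.
by rewrite nth_rcons; have -> : b - m < size ps by lia.
Qed.

Lemma older_parentsP m ps a b :
  older_parents m ps -> (a, b) \in attach m ps -> a < b.
Proof. by move=> /allP/[apply]. Qed.

Lemma pendants_isolated n m ps (v x : 'I_n) :
  older_parents m ps -> m + size ps <= v -> pendants n m ps v x = false.
Proof.
move=> old mv; apply/negP => /andP[_ /or3P[/andP[vm _]||]]; first by lia.
  by move=> /= vx; have := older_parentsP old vx; have [] := mem_attach vx; lia.
by move=> /= /mem_attach[]; lia.
Qed.

Local Open Scope ring_scope.

(** The new vertex is still isolated before its edge is drawn, so the boolean union of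
    edge sets is a sum of matrices. *)
Lemma adjmx_pendants_rcons n m (ps : seq nat) (u v : 'I_n) :
    older_parents m (rcons ps u) -> v = (m + size ps)%N :> nat ->
  adjmx (pendants n m (rcons ps u)) =
    adjmx (pendants n m ps) + (delta_mx u v + delta_mx v u).
Proof.
rewrite older_parents_rcons => /andP[uv old] vE.
have iso x : pendants n m ps v x = false by rewrite pendants_isolated ?vE.
have nuv : (u == v) = false by apply/negP => /eqP uvE; move: uv; rewrite uvE vE ltnn.
apply/matrixP=> x y; rewrite !mxE -!natrD; congr (_%:R).
have -> : pendants n m (rcons ps u) x y =
    [|| pendants n m ps x y, (x == u) && (y == v) | (x == v) && (y == u)] :> bool.
  rewrite /pendants /= /clique_plus_rel attach_rcons !mem_rcons !inE -vE !xpair_eqE.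
  rewrite !(inj_eq val_inj) /=.
  have [->|_] := eqVneq x y; last first.
    by rewrite [(y == u) && _]andbC /= -!orbA; do !bool_congr.
  by case: (eqVneq y u) => [->|]; rewrite ?nuv ?andbF.
have [->|xv] := eqVneq x v.
  by rewrite iso eq_sym nuv; case: (y == u).
have [->|yv] := eqVneq y v; last by rewrite !andbF /= !orbF !addn0.
by rewrite adj_sym iso andbT; case: (x == u).
Qed.

Lemma sum_ltn_ord n m : (m <= n)%N -> (\sum_(z < n) (z < m) = m)%N.
Proof.
move=> mn; rewrite -[RHS]card_ord -sum1_card (big_ord_widen n (fun=> 1%N)) //.
by rewrite [RHS]big_mkcond; apply: eq_bigr => z _; case: (z < m)%N.
Qed.

Section Clique.
Variables (n m : nat).
Hypothesis mn : (m <= n)%N.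
Let K := adjmx (clique_plus n m [::]).

Let KE (x y : 'I_n) :
  K x y = (x < m)%:R * (y < m)%:R * (1 - (x == y)%:R) :> algC.
Proof.
rewrite mxE /= /clique_plus_rel !in_nil !orbF.
by case: eqP; case: (x < m)%N; case: (y < m)%N => _ /=; ring.
Qed.

Let sum_lt : \sum_(z < n) (z < m)%:R = m%:R :> algC.
Proof. by rewrite -natr_sum sum_ltn_ord. Qed.

Let sum_eq (x : 'I_n) (F : 'I_n -> algC) : \sum_z (x == z)%:R * F z = F x.
Proof.
rewrite (bigD1 x) //= eqxx mul1r big1 ?addr0 // => z zx.
by rewrite eq_sym (negPf zx) mul0r.
Qed.

Let K2E (x w : 'I_n) :
  (K ^+ 2) x w = (x < m)%:R * (w < m)%:R * (m%:R - 2 + (x == w)%:R).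
Proof.
rewrite expr2 -mulmxE mxE.
(* Inclusion-exclusion: the middle vertex of a walk of length two is any core vertex
   other than [x] and [w], and the last term matters when these coincide. *)
transitivity (\sum_(z < n) ((x < m)%:R * (w < m)%:R * (z < m)%:R
   - (x == z)%:R * ((x < m)%:R * (w < m)%:R * (z < m)%:R)
   - (w == z)%:R * ((x < m)%:R * (w < m)%:R * (z < m)%:R)
   + (x == z)%:R * ((x == w)%:R * ((x < m)%:R * (w < m)%:R * (z < m)%:R))) : algC).
  apply: eq_bigr => z _; rewrite !KE [z == w]eq_sym.
  by case: (eqVneq x z) => [->|_]; rewrite ?[w == z]eq_sym; case: (z < m)%N => /=;
    rewrite ?mulr1n ?mulr0n; ring.
rewrite !big_split /= !sumrN !sum_eq -mulr_sumr sum_lt.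
by case: eqP => [->|_]; case: (x < m)%N; case: (w < m)%N => /=; rewrite ?mulr1n ?mulr0n; ring.
Qed.

Lemma clique_diag2 (w : 'I_n) : (K ^+ 2) w w = ((w < m) * m.-1)%:R.
Proof.
rewrite K2E eqxx; case wm: (w < m)%N; last by rewrite !mul0r.
have -> : m = m.-1.+1 by lia.
by rewrite /= -natr1; ring.
Qed.

Lemma clique_diag3 (w : 'I_n) : (K ^+ 3) w w = ((w < m) * (m.-1 * m.-2))%:R.
Proof.
rewrite exprS -mulmxE mxE.
transitivity (\sum_(z < n) ((w < m)%:R * (m%:R - 2) * (z < m)%:R
   - (w == z)%:R * ((w < m)%:R * (m%:R - 2) * (z < m)%:R)) : algC).
  apply: eq_bigr => z _; rewrite K2E !KE [z == w]eq_sym.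
  by case: (eqVneq w z) => [->|_]; case: (z < m)%N; case: (w < m)%N => /=; rewrite ?mulr1n ?mulr0n; ring.
rewrite big_split /= !sumrN !sum_eq -mulr_sumr sum_lt.
case wm: (w < m)%N; last by rewrite /=; ring.
case: (m) wm => [//|[_|k _]]; first by rewrite /=; ring.
by rewrite /= !natrM -!natr1; ring.
Qed.
End Clique.

Local Close Scope ring_scope.

(** * Moments of grown graphs *)

(** The degree of [w]: its clique neighbours, its children, and its parent if [w] is a
    new vertex. *)
Definition pendants_degree m (ps : seq nat) w :=
  (w < m) * m.-1 + count_mem w ps + (m <= w < m + size ps).

Lemma pendants_degree_rcons m ps p w :
  pendants_degree m (rcons ps p) w = pendants_degree m ps w + ((w == p) + (w == m + size ps)).
Proof.
rewrite /pendants_degree size_rcons -cats1 count_cat /= addn0 [p == w]eq_sym addnS ltnS.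
rewrite [w <= m + _]leq_eqVlt; have [->|_] := eqVneq w (m + size ps).
  by rewrite leq_addr ltnn; lia.
by rewrite /=; lia.
Qed.

(** The degree of each parent at the moment when its child is attached, summed over the
    growth process; up to constants this is the fourth spectral moment. *)
Definition parent_degrees m ps :=
  \sum_(j < size ps) pendants_degree m (take j ps) (nth 0 ps j).

Lemma parent_degrees_rcons m ps p :
  parent_degrees m (rcons ps p) = parent_degrees m ps + pendants_degree m ps p.
Proof.
rewrite /parent_degrees size_rcons big_ord_recr /= nth_rcons ltnn eqxx.
rewrite -cats1 take_size_cat //; congr (_ + _); apply: eq_bigr => j _.
by rewrite takel_cat 1?ltnW // nth_cat ltn_ord.
Qed.

Local Open Scope ring_scope.

Lemma spectral_moment0 n (G : sgraph n) : spectral_moment G 0 = n%:R.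
Proof. by rewrite spectral_momentE expr0 mxtrace1. Qed.

Lemma spectral_moment1 n (G : sgraph n) : spectral_moment G 1 = 0.
Proof.
by rewrite spectral_momentE expr1 /mxtrace big1 // => i _; rewrite mxE adj_irrefl.
Qed.

Section Attach.
Variables (n m : nat) (ps : seq nat) (u v : 'I_n).
Hypotheses (old : older_parents m (rcons ps u)) (vE : v = (m + size ps)%N :> nat).
Let G := pendants n m ps.
Let H := pendants n m (rcons ps u).

Let oldps : older_parents m ps.
Proof. by move: old; rewrite older_parents_rcons => /andP[]. Qed.
Let uv : u != v.
Proof.
move: old; rewrite older_parents_rcons => /andP[up _].
by apply/eqP => E; move: up; rewrite E vE ltnn.
Qed.
Let Guu : adjmx G u u = 0. Proof. by rewrite mxE adj_irrefl. Qed.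
Let Gvx x : adjmx G v x = 0. Proof. by rewrite mxE /G pendants_isolated ?vE. Qed.
Let Gxv x : adjmx G x v = 0. Proof. by rewrite mxE adj_sym /G pendants_isolated ?vE. Qed.
Let HE := adjmx_pendants_rcons old vE.

Lemma attach_diag2 w :
  (adjmx H ^+ 2) w w = (adjmx G ^+ 2) w w + ((w == u) + (w == v))%:R.
Proof. by rewrite /H HE diag_pendant2. Qed.

Lemma attach_diag3 w : (adjmx H ^+ 3) w w = (adjmx G ^+ 3) w w.
Proof. by rewrite /H HE diag_pendant3. Qed.

Lemma attach_moment2 : spectral_moment H 2 = spectral_moment G 2 + 2.
Proof. by rewrite !spectral_momentE /H HE mxtrace_pendant2. Qed.

Lemma attach_moment3 : spectral_moment H 3 = spectral_moment G 3.
Proof. by rewrite !spectral_momentE /H HE mxtrace_pendant3. Qed.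

Lemma attach_moment4 :
  spectral_moment H 4 = spectral_moment G 4 + (adjmx G ^+ 2) u u *+ 4 + 2.
Proof. by rewrite !spectral_momentE /H HE mxtrace_pendant4. Qed.

Lemma attach_moment5 :
  spectral_moment H 5 = spectral_moment G 5 + (adjmx G ^+ 3) u u *+ 5.
Proof. by rewrite !spectral_momentE /H HE mxtrace_pendant5. Qed.
End Attach.

(** The degrees grow with the process, but a pendant vertex lies in no triangle, so the
    triangle counts remain those of the clique. *)
Lemma pendants_diag n m ps (w : 'I_n) :
    (m + size ps <= n)%N -> older_parents m ps ->
  (adjmx (pendants n m ps) ^+ 2) w w = (pendants_degree m ps w)%:R /\
  (adjmx (pendants n m ps) ^+ 3) w w = ((w < m) * (m.-1 * m.-2))%:R.
Proof.
elim/last_ind: ps => [|ps p IHps].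
  rewrite addn0 => mn _; rewrite clique_diag2 // clique_diag3 //; split=> //.
  by congr (_%:R); rewrite /pendants_degree /= addn0; lia.
rewrite size_rcons addnS => mn old.
have old' := old; move: old'; rewrite older_parents_rcons => /andP[pm oldps].
have pn : (p < n)%N by lia.
pose u := Ordinal pn; pose v := Ordinal mn.
have [IH2 IH3] := IHps (ltnW mn) oldps.
rewrite (@attach_diag2 n m ps u v) // (@attach_diag3 n m ps u v) // IH2 IH3.
split=> //; rewrite -natrD; congr (_%:R).
exact/esym/pendants_degree_rcons.
Qed.

Section Moments.
Variables (n m : nat).
Let K := pendants n m [::].

Lemma pendants_moment2 ps :
    (m + size ps <= n)%N -> older_parents m ps ->
  spectral_moment (pendants n m ps) 2 = spectral_moment K 2 + (2 * size ps)%:R.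
Proof.
elim/last_ind: ps => [|ps p IHps]; first by rewrite addr0.
rewrite size_rcons addnS => mn old.
have old' := old; move: old'; rewrite older_parents_rcons => /andP[pm oldps].
have pn : (p < n)%N by lia.
rewrite (@attach_moment2 n m ps (Ordinal pn) (Ordinal mn)) // IHps ?(ltnW mn) //.
by rewrite -addrA -natrD mulnS addnC.
Qed.

Lemma pendants_moment3 ps :
    (m + size ps <= n)%N -> older_parents m ps ->
  spectral_moment (pendants n m ps) 3 = spectral_moment K 3.
Proof.
elim/last_ind: ps => [//|ps p IHps].
rewrite size_rcons addnS => mn old.
have old' := old; move: old'; rewrite older_parents_rcons => /andP[pm oldps].
have pn : (p < n)%N by lia.
by rewrite (@attach_moment3 n m ps (Ordinal pn) (Ordinal mn)) // IHps ?(ltnW mn).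
Qed.

(** The closed 4-walks through a new pendant edge number 2 plus 4 times the degree of
    the parent. *)
Lemma pendants_moment4 ps :
    (m + size ps <= n)%N -> older_parents m ps ->
  spectral_moment (pendants n m ps) 4 =
    spectral_moment K 4 + (4 * parent_degrees m ps + 2 * size ps)%:R.
Proof.
elim/last_ind: ps => [|ps p IHps].
  by rewrite /parent_degrees big_ord0 addr0.
rewrite size_rcons addnS => mn old.
have old' := old; move: old'; rewrite older_parents_rcons => /andP[pm oldps].
have pn : (p < n)%N by lia.
rewrite (@attach_moment4 n m ps (Ordinal pn) (Ordinal mn)) // IHps ?(ltnW mn) //.
have [-> _] := pendants_diag (Ordinal pn) (ltnW mn) oldps.
rewrite parent_degrees_rcons /= -mulrnA -!addrA -!natrD; congr (_ + _%:R); lia.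
Qed.

(** A closed 5-walk through a new pendant edge runs around a triangle at the parent and
    makes one excursion along the edge.  Such triangles exist only at parents in the
    clique, where they are equally many at each. *)
Lemma pendants_moment5 ps :
    (m + size ps <= n)%N -> older_parents m ps ->
  spectral_moment (pendants n m ps) 5 =
    spectral_moment K 5
    + (5 * (m.-1 * m.-2) * count (fun p => (p < m)%N) ps)%:R.
Proof.
elim/last_ind: ps => [|ps p IHps].
  by rewrite muln0 addr0.
rewrite size_rcons addnS => mn old.
have old' := old; move: old'; rewrite older_parents_rcons => /andP[pm oldps].
have pn : (p < n)%N by lia.
rewrite (@attach_moment5 n m ps (Ordinal pn) (Ordinal mn)) // IHps ?(ltnW mn) //.
have [_ ->] := pendants_diag (Ordinal pn) (ltnW mn) oldps.
rewrite -mulrnA -!addrA -!natrD; congr (_ + _%:R).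
rewrite -cats1 count_cat /=; lia.
Qed.
End Moments.

(** Moments 0 to 3 depend only on the number of attached vertices, so the fourth moment
    decides whenever the sums of parent degrees differ. *)
Lemma precS_pendants n m ps qs :
    (m + size ps <= n)%N -> size qs = size ps -> (4 < n)%N ->
    older_parents m ps -> older_parents m qs ->
    (parent_degrees m ps < parent_degrees m qs)%N ->
  precS (pendants n m ps) (pendants n m qs).
Proof.
move=> psn szq n4 oldp oldq lt_pq; have qsn : (m + size qs <= n)%N by rewrite szq.
exists 4; split; first by lia.
  move=> [|[|[|[|//]]]] _; rewrite ?spectral_moment0 ?spectral_moment1 //.
    by rewrite (@pendants_moment2 _ _ ps) // (@pendants_moment2 _ _ qs) // szq.
  by rewrite (@pendants_moment3 _ _ ps) // (@pendants_moment3 _ _ qs) //.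
by rewrite (@pendants_moment4 _ _ ps) // (@pendants_moment4 _ _ qs) // szq ltrD2l ltr_nat; lia.
Qed.

(** When the sums of parent degrees agree, the graph with more children hanging
    directly from the clique has more pairs of a triangle and a new edge at one of its
    corners. *)
Lemma precS_pendants5 n m ps qs :
    (m + size ps <= n)%N -> size qs = size ps -> (5 < n)%N -> (2 < m)%N ->
    older_parents m ps -> older_parents m qs ->
    parent_degrees m ps = parent_degrees m qs ->
    (count (fun p => (p < m)%N) ps < count (fun p => (p < m)%N) qs)%N ->
  precS (pendants n m ps) (pendants n m qs).
Proof.
move=> psn szq n4 m2 oldp oldq eq_pq lt_pq; have qsn : (m + size qs <= n)%N by rewrite szq.
exists 5; split; first by lia.
  move=> [|[|[|[|[|//]]]]] _; rewrite ?spectral_moment0 ?spectral_moment1 //.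
  - by rewrite (@pendants_moment2 _ _ ps) // (@pendants_moment2 _ _ qs) // szq.
  - by rewrite (@pendants_moment3 _ _ ps) // (@pendants_moment3 _ _ qs) //.
  by rewrite (@pendants_moment4 _ _ ps) // (@pendants_moment4 _ _ qs) // szq eq_pq.
rewrite (@pendants_moment5 _ _ ps) // (@pendants_moment5 _ _ qs) // ltrD2l ltr_nat ltn_pmul2l //.
by case: (m) m2 => [|[|[|k]]].
Qed.

Local Close Scope ring_scope.

(** * Connectedness and clique number of grown graphs *)

Lemma pendants_core n m ps (x y : 'I_n) :
  x < m -> y < m -> pendants n m ps x y = (x != y).
Proof. by move=> xm ym; rewrite /= /clique_plus_rel xm ym /= andbT. Qed.

Lemma pendants_parent n m ps (w v : 'I_n) : older_parents m ps ->
  m <= v -> w <= v -> pendants n m ps w v -> w = nth 0 ps (v - m) :> nat.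
Proof.
move=> old mv wv; rewrite /= /clique_plus_rel [v < m]ltnNge mv andbF /=.
case/andP=> _ /orP[] /=; first by case/mem_attach.
by move/(older_parentsP old); rewrite ltnNge wv.
Qed.

Lemma pendants_edge n m ps (w v : 'I_n) : older_parents m ps ->
  m <= v < m + size ps -> w = nth 0 ps (v - m) :> nat -> pendants n m ps w v.
Proof.
move=> old /andP[mv vs] wE.
have mem : (val w, val v) \in attach m ps.
  have j : v - m < size ps by lia.
  rewrite /= wE; have {2}-> : v = nth 0 (iota m (size ps)) (v - m) :> nat.
    by rewrite nth_iota //; lia.
  by rewrite -nth_zip ?size_iota // mem_nth // size_zip size_iota minnn.
have := older_parentsP old mem; rewrite /= /clique_plus_rel mem orbT andbT => wv.
by apply: contraTneq wv => ->; rewrite ltnn.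
Qed.

Lemma pendants_connected n m ps : 0 < m -> n = m + size ps ->
  older_parents m ps -> connected (pendants n m ps).
Proof.
move=> m0 nE old; have n0 : 0 < n by lia.
pose G := pendants n m ps; pose o := Ordinal n0.
suff to_o (v : 'I_n) : connect G o v.
  apply/forallP=> x; apply/forallP=> y; apply: connect_trans (to_o y).
  by rewrite (sym_connect_sym (@adj_sym _ G)) to_o.
have [k] := ubnP (val v); elim: k v => // k IHk v /=; rewrite ltnS => vk.
have [vm|mv] := ltnP v m.
  have [->|ov] := eqVneq o v; first exact: connect0.
  by apply: connect1; rewrite [X in is_true X](@pendants_core n m ps o v m0 vm).
have vs : v - m < size ps by have := ltn_ord v; lia.
have pv : nth 0 ps (v - m) < v.
  have := all_nthP (0, 0) old (v - m).
  rewrite size_zip size_iota minnn nth_zip ?size_iota // => /(_ vs) /=.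
  by rewrite nth_iota // subnKC.
pose w := Ordinal (ltn_trans pv (ltn_ord v)).
apply: connect_trans (IHk w _) _; first exact: leq_trans pv vk.
apply: connect1; apply: pendants_edge => //.
by rewrite mv -nE ltn_ord.
Qed.

(** The vertex of largest index in a clique that leaves the core has only its parent as
    an older neighbour, so such a clique has at most two vertices. *)
Lemma pendants_clique_number n m ps : 1 < m -> n = m + size ps ->
  older_parents m ps -> clique_number (pendants n m ps) = m.
Proof.
move=> m1 nE old; pose C := [set x : 'I_n | x < m].
have cardC : #|C| = m.
  by rewrite cardsE -sum1_card big_mkcond /= -[RHS](@sum_ltn_ord n m) //; lia.
apply/eqP; rewrite /clique_number eqn_leq; apply/andP; split; last first.
  rewrite -{1}cardC; apply: leq_bigmax_cond.
  apply/forall_inP=> x; rewrite inE => xm; apply/forall_inP=> y; rewrite inE => ym.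
  by apply/implyP; rewrite pendants_core.
apply/bigmax_leqP=> A /forall_inP cliqueA.
have [AC|/subsetPn[v0 v0A]] := boolP (A \subset C).
  by rewrite -cardC subset_leq_card.
rewrite inE -leqNgt => mv0.
have [v vA maxv] : exists2 v, v \in A & forall w : 'I_n, w \in A -> w <= v.
  by have [v] := arg_maxnP (fun i : 'I_n => val i) v0A; exists v.
have mv : m <= v := leq_trans mv0 (maxv v0 v0A).
rewrite (cardsD1 v) vA; apply: leq_trans m1; rewrite add1n ltnS.
suff parent w : w \in A :\ v -> w = nth 0 ps (v - m) :> nat.
  by apply/card_le1_eqP => w1 w2 /parent w1E /parent w2E; apply: val_inj; rewrite /= w1E w2E.
rewrite !inE => /andP[wv wA]; apply: (pendants_parent old mv (maxv w wA)).
by have /forall_inP/(_ v vA)/implyP := cliqueA w wA; apply.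
Qed.

Lemma in_L_pendants n m ps : 1 < m -> n = m + size ps ->
  older_parents m ps -> in_L m (pendants n m ps).
Proof.
move=> m1 nE old; rewrite /in_L pendants_clique_number // eqxx andbT.
by rewrite pendants_connected // ltnW.
Qed.

(** * Recognizing grown graphs by their number of edges *)

Definition arcs n (G : sgraph n) : {set 'I_n * 'I_n} := [set e | G e.1 e.2].

(** Closed walks of length two run along an edge and back, one for each orientation. *)
Lemma spectral_moment2 n (G : sgraph n) : spectral_moment G 2 = (#|arcs G|%:R)%R.
Proof.
rewrite spectral_momentE /mxtrace; transitivity (\sum_i \sum_j ((G i j)%:R : algC))%R.
  apply: eq_bigr => i _; rewrite expr2 -mulmxE mxE; apply: eq_bigr => j _.
  by rewrite !mxE (adj_sym G j) -natrM mulnb andbb.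
rewrite pair_bigA /= -natr_sum -sum1_card [in RHS]big_mkcond /=.
by congr (_%:R)%R; apply: eq_bigr => e _; rewrite inE; case: (G _ _).
Qed.

Lemma precS_arcs n (G H : sgraph n) : 2 < n -> #|arcs G| < #|arcs H| -> precS G H.
Proof.
move=> n2 lt_GH; exists 2; split; first by lia.
  by move=> [|[|//]] _; rewrite ?spectral_moment0 ?spectral_moment1.
by rewrite !spectral_moment2 ltr_nat.
Qed.

(** An edge-preserving injection between finite graphs maps arcs injectively; if the
    target has no more arcs than the source, every arc is hit. *)
Lemma isomorphic_embedding n (G H : sgraph n) (f : 'I_n -> 'I_n) :
    injective f -> (forall x y, H x y -> G (f x) (f y)) ->
    #|arcs G| <= #|arcs H| -> isomorphic G H.
Proof.
move=> injf homf leGH; pose ff (e : 'I_n * 'I_n) := (f e.1, f e.2).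
have injff : injective ff by move=> [x y] [x' y'] [/injf -> /injf ->].
have arcsG : ff @: arcs H = arcs G.
  apply/eqP; rewrite eqEcard card_imset // leGH andbT.
  by apply/subsetP=> _ /imsetP[e He ->]; move: He; rewrite !inE; apply: homf.
have [g fK gK] := injF_bij injf.
exists g; first by exists f.
move=> x y; apply/idP/idP => [Hxy|Gxy].
  by rewrite -[x]gK -[y]gK homf.
have: (x, y) \in arcs G by rewrite inE.
rewrite -arcsG => /imsetP[[x' y']]; rewrite inE /= => Hxy [-> ->].
by rewrite !fK.
Qed.

(** Otherwise the set would be closed under adjacency, and no path could leave it. *)
Lemma outgoing_edge n (G : sgraph n) (B : {set 'I_n}) :
    connected G -> B != set0 -> #|B| < n ->
  exists b x, [/\ b \in B, x \notin B & G b x].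
Proof.
move=> conG /set0Pn[b0 b0B] ltB.
have [x0 x0B] : exists x0, x0 \notin B.
  have: ~: B != set0 by rewrite -card_gt0 cardsCs setCK card_ord subn_gt0.
  by case/set0Pn=> x; rewrite inE; exists x.
case: (pickP [pred e : 'I_n * 'I_n | [&& e.1 \in B, e.2 \notin B & G e.1 e.2]]).
  by move=> [b x] /and3P[]; exists b, x.
move=> noedge; have clB : closed G (mem B).
  apply: (intro_closed (sym_connect_sym (@adj_sym _ G))) => x y Gxy xB.
  by apply: contraFT (noedge (x, y)) => yB; rewrite /= xB yB.
have /forallP/(_ b0)/forallP/(_ x0) := conG.
by move/(closed_connect clB); rewrite b0B (negPf x0B).
Qed.

(** The vertex of [G] that plays the part of [i] in a growth process, when [s] lists the
    first few vertices of the clique and [u] the vertices outside. *)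
Definition lookup n (x0 : 'I_n) m (s u : seq 'I_n) i :=
  if i < m then nth x0 s i else nth x0 u (i - m).

(** Only the clique vertices that serve as parents have to be chosen; the other ones
    complete [s] to an enumeration of [A] in any order.  This enumeration embeds the
    growth graph in [G], and the bound on arcs makes the embedding an isomorphism. *)
Lemma isomorphic_pendants n (G : sgraph n) m ps (A : {set 'I_n}) x0 s u :
    clique G A -> #|A| = m -> {subset s <= A} -> uniq s ->
    {in u, forall x, x \notin A} -> uniq u ->
    n = m + size ps -> size u = size ps -> older_parents m ps ->
    all (fun e => ((e.1 < size s) || (m <= e.1)) && G (lookup x0 m s u e.1) e.2) (zip ps u) ->
    #|arcs G| <= #|arcs (pendants n m ps)| ->
  isomorphic G (pendants n m ps).
Proof.
move=> clA cardA sA us uA uu nE szu old edges.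
pose core := s ++ [seq a <- enum A | a \notin s].
have core_uniq : uniq core.
  rewrite cat_uniq us filter_uniq ?enum_uniq // andbT /=.
  by apply/hasPn=> a; rewrite mem_filter => /andP[].
have coreA : core =i A.
  move=> a; rewrite mem_cat mem_filter mem_enum.
  by case: (boolP (a \in s)) => [/sA->|].
have szcore : size core = m by rewrite -cardA -(eq_card coreA); apply/esym/card_uniqP.
pose all_vx := core ++ u.
have uniq_all : uniq all_vx.
  rewrite cat_uniq core_uniq uu andbT; apply/hasPn=> a /uA.
  by rewrite -coreA.
have sz_all : size all_vx = n by rewrite size_cat szcore szu.
pose f (i : 'I_n) := nth x0 all_vx i.
apply: (@isomorphic_embedding _ _ _ f).
  move=> i j /eqP; rewrite nth_uniq ?sz_all // => /eqP; exact: val_inj.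
have f_lt (i : 'I_n) : i < m -> f i = nth x0 core i.
  by move=> im; rewrite /f nth_cat szcore im.
have f_core (i : 'I_n) : i < m -> f i \in A.
  by move=> im; rewrite f_lt // -coreA mem_nth // szcore.
have f_new (i : 'I_n) : m <= i -> f i = nth x0 u (i - m).
  by move=> im; rewrite /f nth_cat szcore ltnNge im.
have szs : size s <= m by rewrite -szcore size_cat leq_addr.
have new_edge (i j : 'I_n) : (val i, val j) \in attach m ps -> G (f i) (f j).
  move=> /= ij; have [/andP[mj jlt] iE] := mem_attach ij.
  have js : j - m < size ps by lia.
  have /(_ (0, x0) (j - m)) := all_nthP _ edges.
  rewrite size_zip szu minnn nth_zip ?szu // => /(_ js) /=; rewrite -iE -f_new //.
  case/andP=> i_ok; rewrite /lookup.
  have [im|mi] := ltnP i m; last by rewrite -f_new.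
  have i_s : i < size s by case/orP: i_ok => //; rewrite leqNgt im.
  by rewrite (f_lt i) // nth_cat i_s.
move=> i j /andP[ij /or3P[/andP[im jm]|/new_edge//|/new_edge]]; last by rewrite adj_sym.
have /forall_inP/(_ _ (f_core i im))/forall_inP/(_ _ (f_core j jm))/implyP := clA.
apply; apply: contraNneq ij => /eqP.
by rewrite nth_uniq ?sz_all.
Qed.

(** Either side is a second moment, to which every attachment adds 2. *)
Lemma card_arcs_pendants n m ps qs :
    m + size ps <= n -> size qs = size ps ->
    older_parents m ps -> older_parents m qs ->
  #|arcs (pendants n m ps)| = #|arcs (pendants n m qs)|.
Proof.
move=> psn sz oldp oldq; apply/eqP; rewrite -(eqr_nat algC) -!spectral_moment2.
by rewrite (@pendants_moment2 _ _ ps) // (@pendants_moment2 _ _ qs) // sz.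
Qed.

Lemma max_clique n (G : sgraph n) t :
  clique_number G = t -> exists2 A : {set 'I_n}, clique G A & #|A| = t.
Proof.
move=> Gt; have clique0 : 0 < #|[pred A | clique G A]|.
  by apply/card_gt0P; exists set0; apply/forall_inP=> x; rewrite inE.
by have [A clA] := eq_bigmax_cond (fun A : {set 'I_n} => #|A|) clique0; rewrite -Gt; exists A.
Qed.

Section NewVertices.
Variables (n m : nat) (G : sgraph n).
Hypotheses (conG : connected G) (m0 : 0 < m).

(** One step of the exploration of [G] that starts from the clique [A] and has reached the
    vertices [u]. *)
Lemma outgoing_edge_new (A : {set 'I_n}) (u : seq 'I_n) :
    #|A| = m -> m + size u < n ->
  exists b x, [/\ (b \in A) || (b \in u), x \notin A, x \notin u & G b x].
Proof.
move=> cardA un; pose B := A :|: [set x in u].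
have [||b [x []]] := @outgoing_edge n G B conG.
- by rewrite -card_gt0 (leq_trans _ (subset_leq_card (subsetUl _ _))) // cardA.
- apply: leq_ltn_trans un; apply: leq_trans (leq_card_setU _ _) _.
  by rewrite cardA leq_add2l cardsE card_size.
by rewrite !inE negb_or => bB /andP[xA xu] Gbx; exists b, x.
Qed.
End NewVertices.

Arguments lookup : simpl never.

Lemma lookup_core n (x0 : 'I_n) m s u i : i < m -> lookup x0 m s u i = nth x0 s i.
Proof. by rewrite /lookup => ->. Qed.

Lemma lookup_new n (x0 : 'I_n) m s u i : lookup x0 m s u (m + i) = nth x0 u i.
Proof. by rewrite /lookup ltnNge leq_addr addKn. Qed.

Section Classify.
Variables (r m : nat) (G : sgraph (m + r)) (A : {set 'I_(m + r)}) (x0 : 'I_(m + r)).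
Variables (family : seq (seq nat)) (qs : seq nat).
Hypotheses (clA : clique G A) (cardA : #|A| = m).
Hypothesis sizes : all (fun ps => size ps == r) family.
Hypothesis old : all (older_parents m) family.
Hypothesis qs_in : qs \in family.
Hypothesis leG : #|arcs G| <= #|arcs (pendants (m + r) m qs)|.

(** The graphs of a family have equally many arcs, so the bound stated for [qs] serves
    for every member. *)
Lemma classify_case ps s u : ps \in family -> size u = r ->
    all (fun e => ((e.1 < size s) || (m <= e.1)) && G (lookup x0 m s u e.1) e.2) (zip ps u) ->
    all (mem A) s && uniq s -> all [pred z | z \notin A] u && uniq u ->
  exists2 ps, ps \in family & isomorphic G (pendants (m + r) m ps).
Proof.
move=> ps_in szu edges /andP[/allP sA us] /andP[/allP uA uu]; exists ps => //.
have szps ps' : ps' \in family -> size ps' = r by move=> /(allP sizes)/eqP.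
apply: (isomorphic_pendants clA cardA sA us uA uu _ _ (allP old _ ps_in) edges);
  rewrite ?szps //.
apply: leq_trans leG _; rewrite (@card_arcs_pendants _ _ _ ps) ?szps //;
  exact: (allP old).
Qed.
End Classify.

(** The parent lists of [J1], [J2], [J3]. *)
Definition family2 m := [:: [:: 0; m]; [:: 0; 1]; [:: 0; 0]].

(** The parent lists of [J4] to [J10]. *)
Definition family3 m :=
  [:: [:: 0; m; m.+1]; [:: 0; m; m]; [:: 0; m; 1]; [:: 0; m; 0]; [:: 0; 1; 2];
      [:: 0; 0; 1]; [:: 0; 0; 0]].

Lemma family2_old m : 2 < m -> all (older_parents m) (family2 m).
Proof. rewrite /older_parents /=; lia. Qed.

Lemma family3_old m : 2 < m -> all (older_parents m) (family3 m).
Proof. rewrite /older_parents /=; lia. Qed.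

Lemma lookup_new0 n (x0 : 'I_n) m s u : lookup x0 m s u m = nth x0 u 0.
Proof. by rewrite -[X in lookup _ _ _ _ X]addn0 lookup_new. Qed.

Lemma lookup_new1 n (x0 : 'I_n) m s u : lookup x0 m s u m.+1 = nth x0 u 1.
Proof. by rewrite -addn1 lookup_new. Qed.

(* The lookups are computed from the positions known to lie below [m]; what remains is
   an instance of the collected facts. *)
Ltac verify m0 m1 m2 facts :=
  rewrite /= ?(lookup_core _ _ _ m0) ?(lookup_core _ _ _ m1) ?(lookup_core _ _ _ m2)
    ?lookup_new0 ?lookup_new1 ?inE ?negb_or /= ?leqnn ?leqnSn ?eqxx ?orbT ?facts //=.

(** Connectedness yields a vertex [x] next to a clique vertex [a], then a vertex [y] next
    to the clique or [x].  The place of the second attachment decides the isomorphism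
    type. *)
Lemma classify2 m (G : sgraph (m + 2)) : in_L m G -> 2 < m ->
    #|arcs G| <= #|arcs (pendants (m + 2) m [:: 0; 0])| ->
  exists2 ps, ps \in family2 m & isomorphic G (pendants (m + 2) m ps).
Proof.
move=> /andP[conG /eqP/max_clique[A clA cardA]] m2 leG.
have m0 : 0 < m by lia. have m1 : 1 < m by lia.
have [||a [x []]] := @outgoing_edge_new _ m G conG m0 A [::]; rewrite ?ltn_add2l //.
rewrite in_nil orbF => aA xA _ Gax.
have [||b [y []]] := @outgoing_edge_new _ m G conG m0 A [:: x]; rewrite ?ltn_add2l //.
rewrite !inE => bAx yA yx Gby.
have case_of := @classify_case 2 m G A a (family2 m) [:: 0; 0] clA cardA isT (family2_old m2) _ leG.
have xy : x != y by rewrite eq_sym.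
have facts := (aA, xA, yA, Gax, Gby, yx, xy).
have [bA|bA] := boolP (b \in A); last first.
  move: bAx; rewrite (negPf bA) /= => /eqP bx; subst b.
  by apply: (case_of _ [:: 0; m] [:: a] [:: x; y]); verify m0 m1 m2 facts.
have [ba|ba] := eqVneq b a.
  subst b.
  by apply: (case_of _ [:: 0; 0] [:: a] [:: x; y]); verify m0 m1 m2 facts.
have ab : a != b by rewrite eq_sym.
by apply: (case_of _ [:: 0; 1] [:: a; b] [:: x; y]); verify m0 m1 m2 (facts, bA, ab).
Qed.

(** As with two vertices outside the clique, the places of the attachments decide the
    isomorphism type.  The vertices are listed in the order of the parent list, which can
    differ from the order of discovery: the path comes first for [J6] and [J7], the two
    pendant vertices with a common neighbour for [J9]. *)
Lemma classify3 m (G : sgraph (m + 3)) : in_L m G -> 2 < m ->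
    #|arcs G| <= #|arcs (pendants (m + 3) m [:: 0; 0; 0])| ->
  exists2 ps, ps \in family3 m & isomorphic G (pendants (m + 3) m ps).
Proof.
move=> /andP[conG /eqP/max_clique[A clA cardA]] m2 leG.
have m0 : 0 < m by lia. have m1 : 1 < m by lia.
have [||a [x []]] := @outgoing_edge_new _ m G conG m0 A [::]; rewrite ?ltn_add2l //.
rewrite in_nil orbF => aA xA _ Gax.
have [||b [y []]] := @outgoing_edge_new _ m G conG m0 A [:: x]; rewrite ?ltn_add2l //.
rewrite !inE => bAx yA yx Gby.
have [||c [z []]] := @outgoing_edge_new _ m G conG m0 A [:: x; y]; rewrite ?ltn_add2l //.
rewrite !inE !negb_or => cAx zA /andP[zx zy] Gcz.
have case_of := @classify_case 3 m G A a (family3 m) [:: 0; 0; 0] clA cardA isT (family3_old m2) _ leG.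
have xy : x != y by rewrite eq_sym.
have xz : x != z by rewrite eq_sym.
have yz : y != z by rewrite eq_sym.
have facts := (aA, xA, yA, zA, Gax, Gby, Gcz, yx, xy, zx, zy, xz, yz).
have [bA|bA] := boolP (b \in A); last first.
  move: bAx; rewrite (negPf bA) /= => /eqP bx; subst b.
  have [cA|cA] := boolP (c \in A); last first.
    move: cAx; rewrite (negPf cA) /= => /orP[] /eqP cx; subst c.
      by apply: (case_of _ [:: 0; m; m] [:: a] [:: x; y; z]); verify m0 m1 m2 facts.
    by apply: (case_of _ [:: 0; m; m.+1] [:: a] [:: x; y; z]); verify m0 m1 m2 facts.
  have [ca|ca] := eqVneq c a.
    subst c.
    by apply: (case_of _ [:: 0; m; 0] [:: a] [:: x; y; z]); verify m0 m1 m2 facts.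
  have ac : a != c by rewrite eq_sym.
  by apply: (case_of _ [:: 0; m; 1] [:: a; c] [:: x; y; z]); verify m0 m1 m2 (facts, cA, ac).
have [ba|ba] := eqVneq b a.
  subst b.
  have [cA|cA] := boolP (c \in A); last first.
    move: cAx; rewrite (negPf cA) /= => /orP[] /eqP cx; subst c.
      by apply: (case_of _ [:: 0; m; 0] [:: a] [:: x; z; y]); verify m0 m1 m2 facts.
    by apply: (case_of _ [:: 0; m; 0] [:: a] [:: y; z; x]); verify m0 m1 m2 facts.
  have [ca|ca] := eqVneq c a.
    subst c.
    by apply: (case_of _ [:: 0; 0; 0] [:: a] [:: x; y; z]); verify m0 m1 m2 facts.
  have ac : a != c by rewrite eq_sym.
  by apply: (case_of _ [:: 0; 0; 1] [:: a; c] [:: x; y; z]); verify m0 m1 m2 (facts, cA, ac).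
have ab : a != b by rewrite eq_sym.
have [cA|cA] := boolP (c \in A); last first.
  move: cAx; rewrite (negPf cA) /= => /orP[] /eqP cx; subst c.
    by apply: (case_of _ [:: 0; m; 1] [:: a; b] [:: x; z; y]); verify m0 m1 m2 (facts, bA, ab, ba).
  by apply: (case_of _ [:: 0; m; 1] [:: b; a] [:: y; z; x]); verify m0 m1 m2 (facts, bA, ab, ba).
have [ca|ca] := eqVneq c a.
  subst c.
  by apply: (case_of _ [:: 0; 0; 1] [:: a; b] [:: x; z; y]); verify m0 m1 m2 (facts, bA, ab, ba).
have [cb|cb] := eqVneq c b.
  subst c.
  by apply: (case_of _ [:: 0; 0; 1] [:: b; a] [:: y; z; x]); verify m0 m1 m2 (facts, bA, ab, ba).
have ac : a != c by rewrite eq_sym.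
have bc : b != c by rewrite eq_sym.
by apply: (case_of _ [:: 0; 1; 2] [:: a; b; c] [:: x; y; z]);
  verify m0 m1 m2 (facts, bA, cA, ab, ac, bc).
Qed.

(** * The ten graphs in the S-order *)

Lemma J1E m : J1 (m + 2) = pendants (m + 2) m [:: 0; m].
Proof. by rewrite /J1 addnK addn2 subn1. Qed.
Lemma J2E m : J2 (m + 2) = pendants (m + 2) m [:: 0; 1].
Proof. by rewrite /J2 addnK addn2 subn1. Qed.
Lemma J3E m : J3 (m + 2) = pendants (m + 2) m [:: 0; 0].
Proof. by rewrite /J3 addnK addn2 subn1. Qed.

Lemma subn_m3 m : (m + 3 - 3 = m) * (m + 3 - 2 = m.+1) * (m + 3 - 1 = m.+2).
Proof. by rewrite addnK addn3 subn1 subn2. Qed.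

Lemma J4E m : J4 (m + 3) = pendants (m + 3) m [:: 0; m; m.+1].
Proof. by rewrite /J4 !subn_m3. Qed.
Lemma J5E m : J5 (m + 3) = pendants (m + 3) m [:: 0; m; m].
Proof. by rewrite /J5 !subn_m3. Qed.
Lemma J6E m : J6 (m + 3) = pendants (m + 3) m [:: 0; m; 1].
Proof. by rewrite /J6 !subn_m3. Qed.
Lemma J7E m : J7 (m + 3) = pendants (m + 3) m [:: 0; m; 0].
Proof. by rewrite /J7 !subn_m3. Qed.
Lemma J8E m : J8 (m + 3) = pendants (m + 3) m [:: 0; 1; 2].
Proof. by rewrite /J8 !subn_m3. Qed.
Lemma J9E m : J9 (m + 3) = pendants (m + 3) m [:: 0; 0; 1].
Proof. by rewrite /J9 !subn_m3. Qed.
Lemma J10E m : J10 (m + 3) = pendants (m + 3) m [:: 0; 0; 0].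
Proof. by rewrite /J10 !subn_m3. Qed.

Lemma parent_degrees3E m p q r :
  parent_degrees m [:: p; q; r] =
    pendants_degree m [::] p + pendants_degree m [:: p] q
    + pendants_degree m [:: p; q] r.
Proof. by rewrite /parent_degrees !big_ord_recr big_ord0. Qed.

Lemma parent_degrees2E m p q :
  parent_degrees m [:: p; q] = pendants_degree m [::] p + pendants_degree m [:: p] q.
Proof. by rewrite /parent_degrees !big_ord_recr big_ord0. Qed.

(** Here [d] is the degree of a vertex of the bare clique. *)
Lemma parent_degrees2 m : 2 < m -> exists2 d, m = d.+1 &
  [/\ parent_degrees m [:: 0; m] = d + 1,
      parent_degrees m [:: 0; 1] = d + d &
      parent_degrees m [:: 0; 0] = d + (d + 1)].
Proof.
case: m => [//|d] d2; exists d => //.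
by rewrite !parent_degrees2E /pendants_degree /=; split; lia.
Qed.

Lemma order2 m : 2 < m ->
  precS (J1 (m + 2)) (J2 (m + 2)) /\ precS (J2 (m + 2)) (J3 (m + 2)).
Proof.
move=> m2; rewrite J1E J2E J3E; have [d dE [d1 d2 d3]] := parent_degrees2 m2.
have [old1 old2 old3 _] := and4P (family2_old m2).
by split; apply: precS_pendants => //; lia.
Qed.

Lemma parent_degrees3 m : 2 < m -> exists2 d, m = d.+1 &
  parent_degrees m [:: 0; m; m.+1] = d + 2 /\
      parent_degrees m [:: 0; m; m] = d + 3 /\
      parent_degrees m [:: 0; m; 1] = 2 * d + 1 /\
      parent_degrees m [:: 0; m; 0] = 2 * d + 2 /\
      parent_degrees m [:: 0; 1; 2] = 3 * d /\
      parent_degrees m [:: 0; 0; 1] = 3 * d + 1 /\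
      parent_degrees m [:: 0; 0; 0] = 3 * d + 3.
Proof.
case: m => [//|d] d2; exists d => //.
by rewrite !parent_degrees3E /pendants_degree /=; do !apply: conj; lia.
Qed.

(** With [d] the degree in the bare clique, the sums [d + 3] and [2 * d + 1] for [J5] and
    [J6], and [2 * d + 2] and [3 * d] for [J7] and [J8], agree exactly when the clique is
    a triangle; the fifth moment separates these two pairs. *)
Lemma order3 m : 2 < m ->
  precS (J4 (m + 3)) (J5 (m + 3)) /\ precS (J5 (m + 3)) (J6 (m + 3)) /\
  precS (J6 (m + 3)) (J7 (m + 3)) /\ precS (J7 (m + 3)) (J8 (m + 3)) /\
  precS (J8 (m + 3)) (J9 (m + 3)) /\ precS (J9 (m + 3)) (J10 (m + 3)).
Proof.
move=> m2; rewrite J4E J5E J6E J7E J8E J9E J10E.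
have [d dE [d4 [d5 [d6 [d7 [d8 [d9 d10]]]]]]] := parent_degrees3 m2.
have := family3_old m2; rewrite /= andbT => /and3P[old4 old5 /and5P[old6 old7 old8 old9 old10]].
do !apply: conj; try by apply: precS_pendants => //; lia.
  have [d2|d2] := eqVneq d 2; last by apply: precS_pendants => //; lia.
  by apply: precS_pendants5 => //=; lia.
have [d2|d2] := eqVneq d 2; last by apply: precS_pendants => //; lia.
by apply: precS_pendants5 => //=; lia.
Qed.

Theorem theorem3p4 (n t : nat) :
  (t = n - 2 -> 3 <= t ->
    [/\ in_L t (J1 n), in_L t (J2 n) & in_L t (J3 n)] /\
    precS (J1 n) (J2 n) /\ precS (J2 n) (J3 n) /\
    (forall G : sgraph n, in_L t G ->
       ~ isomorphic G (J1 n) -> ~ isomorphic G (J2 n) ->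
       ~ isomorphic G (J3 n) ->
       precS (J3 n) G))
  /\
  (t = n - 3 -> 3 <= t ->
    (in_L t (J4 n) /\ in_L t (J5 n) /\ in_L t (J6 n) /\ in_L t (J7 n) /\
     in_L t (J8 n) /\ in_L t (J9 n) /\ in_L t (J10 n)) /\
    precS (J4 n) (J5 n) /\ precS (J5 n) (J6 n) /\ precS (J6 n) (J7 n) /\
    precS (J7 n) (J8 n) /\ precS (J8 n) (J9 n) /\ precS (J9 n) (J10 n) /\
    (forall G : sgraph n, in_L t G ->
       ~ isomorphic G (J4 n) -> ~ isomorphic G (J5 n) ->
       ~ isomorphic G (J6 n) -> ~ isomorphic G (J7 n) ->
       ~ isomorphic G (J8 n) -> ~ isomorphic G (J9 n) ->
       ~ isomorphic G (J10 n) ->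
       precS (J10 n) G)).
Proof.
split=> tE t3.
  have nE : n = t + 2 by lia.
  subst n; clear tE; have t1 : 1 < t by lia.
  have [prec12 prec23] := order2 t3.
  have [old1 old2 old3 _] := and4P (family2_old t3).
  split; first by split; rewrite ?J1E ?J2E ?J3E in_L_pendants.
  do 2!(apply: conj; first by assumption); move=> G GL.
  have [leG|ltG _ _ _] := leqP #|arcs G| #|arcs (J3 (t + 2))|; last first.
    by apply: precS_arcs ltG; lia.
  rewrite J3E in leG; have [ps ps_in isoG] := classify2 GL t3 leG.
  rewrite J1E J2E J3E => n1 n2 n3; exfalso; move: ps_in isoG; rewrite !inE.
  by case/or3P=> /eqP-> => [/n1|/n2|/n3].
have nE : n = t + 3 by lia.
subst n; clear tE; have t1 : 1 < t by lia.
have [? [? [? [? []]]]] := order3 t3.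
have := family3_old t3; rewrite /= andbT => /and3P[? ? /and5P[? ? ? ? ?]].
split; first by do !apply: conj; rewrite ?J4E ?J5E ?J6E ?J7E ?J8E ?J9E ?J10E in_L_pendants.
do 6!(apply: conj; first by assumption); move=> G GL.
have [leG|ltG *] := leqP #|arcs G| #|arcs (J10 (t + 3))|; last first.
  by apply: precS_arcs ltG; lia.
rewrite J10E in leG; have [ps ps_in isoG] := classify3 GL t3 leG.
rewrite J4E J5E J6E J7E J8E J9E J10E => n4 n5 n6 n7 n8 n9 n10; exfalso.
move: ps_in isoG; rewrite !inE.
case/orP=> [/eqP-> /n4 //|]; case/orP=> [/eqP-> /n5 //|].
case/orP=> [/eqP-> /n6 //|]; case/orP=> [/eqP-> /n7 //|].
case/orP=> [/eqP-> /n8 //|]; case/orP=> [/eqP-> /n9 //|].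
by move=> /eqP-> /n10.
Qed.
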